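(* Let $g:\mathbb{N}\to\mathbb{C}$ be an arithmetic function with $g(1)=1$ such that the power series $\sum_{n=1}^{\infty} g(n)T^n$ is analytic at $T=0$ (i.e. has positive radius of convergence). Let $\tilde{g}(n)=g(n)/n$. Then for all integers $1\le m\le n$, $$A_{n,m}^{g,\mathrm{id}}=\frac{1}{m!}\,A_{n,m}^{\tilde{g},1},$$ where $A_{n,m}^{g,\mathrm{id}}$ and $A_{n,m}^{\tilde g,1}$ are the coefficients of $x^m$ in the polynomials $P_n^{g,\mathrm{id}}(x)$ and $P_n^{\tilde g,1}(x)$, respectively.
   Context: Here $\mathbb{N}=\{1,2,3,\dots\}$, $\mathrm{id}(n)=n$ and $1(n)=1$. For arithmetic functions $g,h$ on $\mathbb{N}$ with $g(1)=h(1)=1$ and $h$ nowhere zero, the polynomials $P_n^{g,h}(x)$ are defined by $P_0^{g,h}(x)=1$ and, for $n\ge 1$, $$P_n^{g,h}(x)=\frac{x}{h(n)}\sum_{k=1}^{n} g(k)\,P_{n-k}^{g,h}(x).$$ For $n\ge 1$, $P_n^{g,h}$ has zero constant term and degree $n$; write $P_n^{g,h}(x)=\sum_{m=1}^n A_{n,m}^{g,h}x^m$. *)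

(* Defs.v *)
From HB Require Import structures.
From mathcomp Require Import all_boot all_order all_algebra complex.
From mathcomp Require Import all_classical all_reals all_analysis.

Set Implicit Arguments.
Unset Strict Implicit.
Unset Printing Implicit Defensive.

Import Order.TTheory GRing.Theory Num.Theory.
Import numFieldNormedType.Exports.

Local Open Scope ring_scope.
Local Open Scope complex_scope.

(* An arithmetic function on {1, 2, 3, ...} is encoded as a function on nat   *)
(* whose value at 0 is never used by any of the definitions below.            *)

(* Course-of-values recursion: recpolys g h n = [:: P_n; P_(n-1); ...; P_0],  *)
(* so that the item of index k is P_(n-k).                                    *)
Fixpoint recpolys (F : fieldType) (g h : nat -> F) (n : nat) : seq {poly F} :=
  if n isn't n'.+1 then [:: 1]
  else let s := recpolys g h n' in
       ((h n)^-1 *: ('X * \sum_(k < n) g k.+1 *: nth 0 s k)) :: s.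

Definition recpoly (F : fieldType) (g h : nat -> F) (n : nat) : {poly F} :=
  head 0 (recpolys g h n).

Lemma recpoly0 (F : fieldType) (g h : nat -> F) : recpoly g h 0 = 1.
Proof. by []. Qed.

Lemma nth_recpolys (F : fieldType) (g h : nat -> F) (n k : nat) :
  (k <= n)%N -> nth 0 (recpolys g h n) k = recpoly g h (n - k).
Proof.
elim: n k => [|n IHn] [|k] //= lekn.
by rewrite IHn // subSS.
Qed.

Lemma recpolyE (F : fieldType) (g h : nat -> F) (n : nat) : (0 < n)%N ->
  recpoly g h n =
  (h n)^-1 *: ('X * \sum_(1 <= k < n.+1) g k *: recpoly g h (n - k)).
Proof.
case: n => // n _; rewrite {1}/recpoly /= big_add1 big_mkord.
congr (_ *: ('X * _)); apply: eq_bigr => k _.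
by rewrite nth_recpolys ?subSS // -ltnS.
Qed.

Definition reccoef (F : fieldType) (g h : nat -> F) (n m : nat) : F :=
  (recpoly g h n)`_m.

(* The power series \sum_(n >= 1) g n * T ^ n has positive radius of          *)
(* convergence. The alias R[i]^o carries the topology of the modulus.         *)
Definition analytic_at0 (R : realType) (g : nat -> R[i]) : Prop :=
  exists2 r : R, 0 < r &
    forall z : R[i], `|z| < r%:C ->
      cvgn (series (fun n : nat => g n.+1 * z ^+ n.+1 : R[i]^o)).

(* Main.v *)
Require Import Defs.
From mathcomp Require Import all_boot all_order all_algebra complex.
From mathcomp Require Import all_reals.
Import GRing.Theory Num.Theory.

Local Open Scope ring_scope.
Local Open Scope complex_scope.

(** Write G(T) for the formal power series with coefficients [g k / k], and
    B(n, m) for the coefficients built from [k |-> g k / k] with [h = 1]. The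
    recursion for [h = 1] says that B(n, m) is the coefficient of T^n in G^m
    ([reccoef1_expr]). Since T G'(T) has coefficients [g k], the identity
    T (G^(m+1))' = (m+1) (T G') G^m gives B a second recursion
    ([natr_mul_reccoef1]):
      n B(n, m+1) = (m+1) \sum_(1 <= k <= n) g k B(n-k, m).
    The defining recursion of the coefficients A(n, m) for [h = id] is the
    same one without the factor m+1. These factors accumulate to m!, so
    m! A(n, m) and B(n, m) obey the same recursion and the same initial values.
    Characteristic 0 makes the divisions by k in G and by n in the recursion
    for A legitimate. *)

Lemma reccoef_n0 (F : fieldType) (g h : nat -> F) (n : nat) :
  reccoef g h n 0 = (n == 0)%:R.
Proof.
rewrite /reccoef; case: n => [|n]; first by rewrite recpoly0 coef1.
by rewrite recpolyE // coefZ coefXM mulr0.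
Qed.

Lemma reccoef_0S (F : fieldType) (g h : nat -> F) (m : nat) :
  reccoef g h 0 m.+1 = 0.
Proof. by rewrite /reccoef recpoly0 coef1. Qed.

Lemma reccoefS (F : fieldType) (g h : nat -> F) (n m : nat) : (0 < n)%N ->
  reccoef g h n m.+1 =
  (h n)^-1 * \sum_(1 <= k < n.+1) g k * reccoef g h (n - k) m.
Proof.
move=> n_gt0; rewrite /reccoef recpolyE // coefZ coefXM /= coef_sum.
by congr (_ * _); apply: eq_bigr => k _; rewrite coefZ.
Qed.

(** The value [c 0] is overwritten because arithmetic functions start at 1.
    Truncating at degree [N] loses nothing for coefficients of index at most
    [N], and lets polynomials stand in for formal power series. *)
Definition genpoly {F : fieldType} (c : nat -> F) (N : nat) : {poly F} :=
  \poly_(k < N.+1) (if k == 0 then 0 else c k).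

(** Extracting the coefficient of T^n in G * G^m gives the recursion for
    [h = 1]; the term of index 0 vanishes as G has no constant term. *)
Lemma reccoef1_expr {F : fieldType} (c : nat -> F) (N n m : nat) :
  (n <= N)%N -> reccoef c (fun=> 1) n m = (genpoly c N ^+ m)`_n.
Proof.
elim: m n => [|m IHm] n le_nN; first by rewrite reccoef_n0 expr0 coef1.
rewrite exprS coefM -(big_mkord xpredT
  (fun k => (genpoly c N)`_k * (genpoly c N ^+ m)`_(n - k))).
rewrite big_ltn // coef_poly /= mul0r add0r.
case: n le_nN => [|n] le_nN; first by rewrite reccoef_0S big_geq.
rewrite reccoefS // invr1 mul1r; apply: eq_big_nat => -[|k] // /andP[_ le_kn].
rewrite IHm; last exact: leq_trans (leq_subr _ _) le_nN.
by rewrite coef_poly /= ltnS (leq_trans _ le_nN).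
Qed.

(** The coefficient of T^n in T (G^(m+1))' = (m+1) (T G') G^m: the division
    by [k] in the coefficients of G is undone by the derivative. *)
Lemma natr_mul_reccoef1 (F : fieldType) (g : nat -> F) (n m : nat) :
    [pchar F] =i pred0 ->
  let B := reccoef (fun k => g k / k%:R) (fun=> 1) in
  n%:R * B n m.+1 = m.+1%:R * \sum_(1 <= k < n.+1) g k * B (n - k)%N m.
Proof.
move=> /pcharf0P char0 B; case: n => [|n]; first by rewrite mul0r big_geq ?mulr0.
have BE n' m' : (n' <= n.+1)%N ->
    B n' m' = (genpoly (fun k => g k / k%:R) n.+1 ^+ m')`_n'.
  exact: reccoef1_expr.
rewrite BE // !mulr_natl -coef_deriv deriv_exp coefMn coefM.
congr (_ *+ _); rewrite big_add1 big_mkord; apply: eq_bigr => k _.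
rewrite subSS BE; last exact: leq_trans (leq_subr _ _) (leqnSn n).
rewrite coef_deriv coef_poly /= ltnS ltn_ord -[X in X * _]mulr_natr.
by rewrite divfK ?char0.
Qed.

(** Induction on [m]: the two recursions differ by the factor m+1, which is
    what (m+1)! gains over m!. *)
Lemma reccoef_id_fact (F : fieldType) (g : nat -> F) (n m : nat) :
    [pchar F] =i pred0 ->
  m`!%:R * reccoef g (fun k => k%:R) n m =
  reccoef (fun k => g k / k%:R) (fun=> 1) n m.
Proof.
move=> char0; elim: m n => [|m IHm] n; first by rewrite mul1r !reccoef_n0.
case: n => [|n]; first by rewrite !reccoef_0S mulr0.
have n_neq0 : n.+1%:R != 0 :> F by move/pcharf0P: char0 => ->.
apply: (mulfI n_neq0); rewrite natr_mul_reccoef1 // mulrCA.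
rewrite reccoefS // mulVKf // factS natrM -mulrA; congr (_ * _).
by rewrite mulr_sumr; apply: eq_bigr => k _; rewrite mulrCA IHm.
Qed.

Theorem theorem1 (R : realType) (g : nat -> R[i]) (g1 : g 1%N = 1)
    (g_analytic : analytic_at0 g) (n m : nat) (m_ge1 : (1 <= m)%N)
    (m_le_n : (m <= n)%N) :
  reccoef g (fun k : nat => k%:R) n m =
  (m`!%:R)^-1 * reccoef (fun k : nat => g k / k%:R) (fun _ : nat => 1) n m.
Proof.
rewrite -reccoef_id_fact; last exact: pchar_num.
by rewrite mulKf // pnatr_eq0 -lt0n fact_gt0.
Qed.
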